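(* Let $n\geq 1$, let $T\subseteq\mathbb{R}^n$ and let $\beta$ be the corresponding betweenness relation. Assume that $T$ extends linearly in 2D. Then the first-order theory of the unary expansion class of $(T,\beta)$ is $\Sigma^0_1$-hard.
   Context: $\beta$ on $T$ is the restriction of the Euclidean betweenness relation: $\beta(s,t,u)$ iff $d(s,u)=d(s,t)+d(t,u)$, $d$ the Euclidean metric. $\beta^*(s,t,u)$ means $\beta(s,t,u)$, $s\neq t$, $t\neq u$; $s,t,u$ are collinear iff $\beta(s,t,u)\vee\beta(s,u,t)\vee\beta(t,s,u)$. For $U\subseteq\mathbb{R}^n$, a line in $U$ is a set $L\subseteq U$ containing two distinct points, any three of whose points are collinear, and such that for $s\neq t$ in $L$ and $u\in U$, $\beta(s,u,t)$ or $\beta(s,t,u)$ implies $u\in L$. An $m$-dimensional flat of $\mathbb{R}^n$ is a set $\{h+r_1v_1+\dots+r_mv_m : r_i\in\mathbb{R}\}$ for some $h\in\mathbb{R}^n$ and linearly independent nonzero $v_1,\dots,v_m$. A nonempty $U\subseteq\mathbb{R}^n$ is a linearly regular $m$-dimensional flat if: $U$ is contained in some $m$-dimensional flat; $U$ is not contained in any $(m-1)$-dimensional flat; $U$ is linearly complete (for every line $L$ in $U$, with $L'$ the line of $\mathbb{R}^n$ containing $L$, every point of $L'$ is a limit of points of $L$); and $U$ is linearly closed (if $L_1\neq L_2$ are lines in $U$ whose extensions to lines of $\mathbb{R}^n$ intersect, then $L_1\cap L_2\neq\emptyset$). $T$ extends linearly in 2D if there exist a linearly regular 2-dimensional flat $S$,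 $\epsilon>0$ and $x\in S\cap T$ with $\{u\in S: d(x,u)<\epsilon\}\subseteq T$. The unary expansion class of $(T,\beta)$ is the class of all expansions $(T,\beta,P)$ with $P\subseteq T$ unary; its first-order theory is the set of first-order $\{\beta,P\}$-sentences true in every structure of the class. Hardness is with respect to computable many-one reductions. *)

(* Defs.v *)
From mathcomp Require Export all_boot all_order all_algebra.
From mathcomp Require Export boolp classical_sets reals.

Set Implicit Arguments.
Unset Strict Implicit.
Unset Printing Implicit Defensive.

Import Order.TTheory GRing.Theory Num.Theory.

Local Open Scope classical_set_scope.
Local Open Scope ring_scope.

(* The norm that the library puts on row vectors is the supremum norm, hence
   this explicit Euclidean metric. *)
Definition dist (R : realType) (n : nat) (s t : 'rV[R]_n) : R :=
  Num.sqrt (\sum_(i < n) (s ord0 i - t ord0 i) ^+ 2).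

Definition betw (R : realType) (n : nat) (s t u : 'rV[R]_n) : Prop :=
  dist s u = dist s t + dist t u.

Definition collinear (R : realType) (n : nat) (s t u : 'rV[R]_n) : Prop :=
  [\/ betw s t u, betw s u t | betw t s u].

Definition is_line_in (R : realType) (n : nat) (U L : set 'rV[R]_n) : Prop :=
  [/\ L `<=` U,
      exists s t, [/\ L s, L t & s <> t],
      forall s t u, L s -> L t -> L u -> collinear s t u &
      forall s t u, L s -> L t -> s <> t -> U u ->
        betw s u t \/ betw s t u -> L u].

Definition is_flat (R : realType) (n m : nat) (F : set 'rV[R]_n) : Prop :=
  exists (h : 'rV[R]_n) (v : m.-tuple 'rV[R]_n), free v /\
    F = [set h + \sum_(i < m) r i *: tnth v i | r in [set: 'I_m -> R]].

Definition linearly_complete (R : realType) (n : nat) (U : set 'rV[R]_n) :=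
  forall L L' : set 'rV[R]_n,
    is_line_in U L -> is_line_in setT L' -> L `<=` L' ->
    forall p, L' p -> forall e : R, 0 < e -> exists2 q, L q & dist p q < e.

Definition linearly_closed (R : realType) (n : nat) (U : set 'rV[R]_n) :=
  forall L1 L2 L1' L2' : set 'rV[R]_n,
    is_line_in U L1 -> is_line_in U L2 -> L1 <> L2 ->
    is_line_in setT L1' -> L1 `<=` L1' ->
    is_line_in setT L2' -> L2 `<=` L2' ->
    L1' `&` L2' !=set0 -> L1 `&` L2 !=set0.

(* The third clause says "m - 1" without truncated subtraction: for m = 0 there
   is no flat of dimension m - 1 and the clause is void. *)
Definition linearly_regular_flat (R : realType) (n m : nat)
    (U : set 'rV[R]_n) : Prop :=
  [/\ U !=set0,
      exists2 F, is_flat m F & U `<=` F,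
      forall (k : nat) F, m = k.+1 -> is_flat k F -> ~ U `<=` F,
      linearly_complete U &
      linearly_closed U].

Definition extends_linearly_2D (R : realType) (n : nat)
    (T : set 'rV[R]_n) : Prop :=
  exists (S : set 'rV[R]_n) (e : R) (x : 'rV[R]_n),
    [/\ linearly_regular_flat 2 S, 0 < e, (S `&` T) x &
        [set u | S u /\ dist x u < e] `<=` T].

(* Variables are named by natural numbers. *)
Inductive formula : Type :=
| Eq of nat & nat
| Beta of nat & nat & nat
| Pred of nat
| Neg of formula
| And of formula & formula
| Ex of nat & formula.

Fixpoint free_vars (phi : formula) : seq nat :=
  match phi with
  | Eq i j => [:: i; j]
  | Beta i j k => [:: i; j; k]
  | Pred i => [:: i]
  | Neg f => free_vars f
  | And f g => free_vars f ++ free_vars g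
  | Ex i f => [seq j <- free_vars f | j != i]
  end.

Definition sentence (phi : formula) : Prop := free_vars phi = [::].

Record structure : Type := Structure {
  domain : Type;
  beta_of : domain -> domain -> domain -> Prop;
  pred_of : set domain }.

Fixpoint sat (M : structure) (a : nat -> domain M) (phi : formula) : Prop :=
  match phi with
  | Eq i j => a i = a j
  | Beta i j k => beta_of (a i) (a j) (a k)
  | Pred i => pred_of (a i)
  | Neg f => ~ sat a f
  | And f g => sat a f /\ sat a g
  | Ex i f => exists d : domain M, sat (fun j => if j == i then d else a j) f
  end.

(* For a sentence and a nonempty domain the choice of assignment is
   irrelevant. *)
Definition models (M : structure) (phi : formula) : Prop :=
  forall a : nat -> domain M, sat a phi.

(* A class of structures is a predicate in [structure -> Prop] and not a [set],
   as the universe of [set] is too small for it. *)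
Definition theory_of (K : structure -> Prop) : set formula :=
  [set phi | sentence phi /\ forall M, K M -> models M phi].

(* T is coerced to the type of its points, so that P ranges over its subsets. *)
Definition expansion (R : realType) (n : nat) (T : set 'rV[R]_n)
    (P : set T) : structure :=
  Structure (fun s t u : T => betw (val s) (val t) (val u)) P.

Definition unary_expansion_class (R : realType) (n : nat)
    (T : set 'rV[R]_n) (M : structure) : Prop :=
  exists P : set T, M = expansion P.

(* [CodeSeq.code] is a bijection from [seq nat] to [nat], computable by
   code [::] = 0 and code (x :: s) = 2 ^ x * (2 * code s + 1). *)
Fixpoint godel (phi : formula) : nat :=
  match phi with
  | Eq i j => CodeSeq.code [:: 0; i; j]
  | Beta i j k => CodeSeq.code [:: 1; i; j; k]
  | Pred i => CodeSeq.code [:: 2; i]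
  | Neg f => CodeSeq.code [:: 3; godel f]
  | And f g => CodeSeq.code [:: 4; godel f; godel g]
  | Ex i f => CodeSeq.code [:: 5; i; godel f]
  end%N.

Lemma godel_inj : injective godel.
Proof.
have code_inj := can_inj CodeSeq.codeK.
elim=> [i j|i j k|i|f IHf|f IHf g IHg|i f IHf];
  case=> [i' j'|i' j' k'|i'|f'|f' g'|i' f'] /code_inj // [].
- by move=> -> ->.
- by move=> -> -> ->.
- by move=> ->.
- by move=> /IHf ->.
- by move=> /IHf -> /IHg ->.
- by move=> -> /IHf ->.
Qed.

(* Arities are left implicit: arguments are passed as a list, and an argument
   beyond the end of the list is read as 0. *)
Inductive recfun : Type :=
| RZero
| RSucc
| RProj of nat
| RComp of recfun & seq recfun
| RPrec of recfun & recfun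
| RMin of recfun.

(* [rec_eval f v y]: the function f is defined at v, with value y. Primitive
   recursion is on the first argument,
     h(0, v) = f(v),  h(m + 1, v) = g(m, h(m, v), v),
   and minimization returns the least y such that f(y, v) = 0, f being defined
   at all (z, v) with z < y. *)
Fixpoint rec_eval (f : recfun) (v : seq nat) (y : nat) {struct f} : Prop :=
  match f with
  | RZero => y = 0
  | RSucc => y = (nth 0 v 0).+1
  | RProj i => y = nth 0 v i
  | RComp g hs =>
      exists2 w : seq nat,
        (fix eval_all (hs : seq recfun) (w : seq nat) {struct hs} : Prop :=
           match hs, w with
           | [::], [::] => True
           | h :: hs', x :: w' => rec_eval h v x /\ eval_all hs' w'
           | _, _ => False
           end) hs w
        & rec_eval g w y
  | RPrec g h =>
      (fix eval_rec (m y : nat) {struct m} : Prop :=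
         match m with
         | 0 => rec_eval g (behead v) y
         | m'.+1 =>
             exists2 z, eval_rec m' z & rec_eval h [:: m', z & behead v] y
         end) (head 0 v) y
  | RMin g =>
      rec_eval g (y :: v) 0 /\
      forall z : nat, (z < y)%N -> exists w : nat, rec_eval g (z :: v) w.+1
  end%N.

Definition computable (f : nat -> nat) : Prop :=
  exists p : recfun, forall x : nat, rec_eval p [:: x] (f x).

Definition computable_rel (r : nat -> nat -> bool) : Prop :=
  exists p : recfun, forall x y : nat, rec_eval p [:: x; y] (r x y).

Definition Sigma01 (A : set nat) : Prop :=
  exists2 r : nat -> nat -> bool, computable_rel r &
    forall x : nat, A x <-> exists y : nat, r x y.

Definition many_one_reducible (A B : set nat) : Prop :=
  exists2 f : nat -> nat, computable f & forall x : nat, A x <-> B (f x).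

Definition Sigma01_hard (B : set nat) : Prop :=
  forall A : set nat, Sigma01 A -> many_one_reducible A B.

(* Main.v *)
Require Import Defs.
From mathcomp Require Import ring lra zify.

Set Implicit Arguments.
Unset Strict Implicit.
Unset Printing Implicit Defensive.

Local Open Scope classical_set_scope.

(** A computably enumerable set is the set of inputs on which a term of a small
    combinator language over binary trees has a value, and the evaluation
    relation of that language is the least one closed under twelve Horn rules.
    A subset P of T can code a predicate on trees: a point of P is a tree when a
    point of P lies strictly between it and a tag point o1, and the tree (a, b)
    lies strictly between the o1-midpoint of a and the o2-midpoint of b (a
    "midpoint" being any point of P strictly in between); a tree is marked as true
    by a midpoint with a third tag point o3. The reduction sends x to the sentence
    "if P codes total pairing and the rules hold for the marked trees, then some
    tree stating that the input x has a value is marked". If the statement is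
    derivable, the rules force the mark for every P. If it is not, the sentence
    fails for a P that marks exactly the derivable statements; its points are
    chosen inductively in the part of the flat inside T, avoiding the finitely
    many lines through earlier points, so that the only betweenness relations in
    P are the intended ones. The choice is possible because lines of a linearly
    complete flat are dense in the lines of the ambient space; hence a segment
    between points of the flat is not covered by finitely many other lines. *)

(** * Evaluation of combinators on trees *)

Inductive tree := Leaf | Node of tree & tree.

Definition tnat (m : nat) : tree := iter m (Node Leaf) Leaf.
Definition tseq (v : seq nat) : tree := foldr (fun x => Node (tnat x)) Leaf v.

Definition cZero := Node (tnat 0) Leaf.
Definition cId := Node (tnat 1) Leaf.
Definition cCar := Node (tnat 2) Leaf.
Definition cCdr := Node (tnat 3) Leaf.
Definition cCons f g := Node (tnat 4) (Node f g).
Definition cComp f g := Node (tnat 5) (Node f g).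
Definition cPrec f g := Node (tnat 6) (Node f g).
Definition cMin f := Node (tnat 7) f.

(* The trees code natural numbers, lists and programs. [Leaf] is both 0 and the
   empty list, and its components are again [Leaf], as a missing argument is
   read as 0. [cMin f] applied to (m, v) searches upwards from m. *)
Inductive ev : tree -> tree -> tree -> Prop :=
| EvZero v : ev cZero v Leaf
| EvId v : ev cId v v
| EvCar0 : ev cCar Leaf Leaf
| EvCar a b : ev cCar (Node a b) a
| EvCdr0 : ev cCdr Leaf Leaf
| EvCdr a b : ev cCdr (Node a b) b
| EvCons f g v a b : ev f v a -> ev g v b -> ev (cCons f g) v (Node a b)
| EvComp f g v a b : ev g v a -> ev f a b -> ev (cComp f g) v b
| EvPrec0 f g v a : ev f v a -> ev (cPrec f g) (Node Leaf v) a
| EvPrecS f g m v a b : ev (cPrec f g) (Node m v) a ->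
    ev g (Node m (Node a v)) b -> ev (cPrec f g) (Node (Node Leaf m) v) b
| EvMin0 f m v : ev f (Node m v) Leaf -> ev (cMin f) (Node m v) m
| EvMinS f m v a b : ev f (Node m v) (Node Leaf a) ->
    ev (cMin f) (Node (Node Leaf m) v) b -> ev (cMin f) (Node m v) b.

(** Only [EvMin0] and [EvMinS] can both match the same program and argument; they demand different
    values of the tested function, which the induction hypothesis rules out. *)
Lemma ev_functional c v u u' : ev c v u -> ev c v u' -> u = u'.
Proof.
move=> e; elim: e u' => {c v u}.
all: intros; match goal with H : ev _ _ ?u |- _ = ?u => inversion H; subst; clear H end.
all: repeat match goal with
  | IH : forall u', ev ?c ?v u' -> ?a = u', H : ev ?c ?v ?w |- _ =>
      have := IH _ H; clear H; (discriminate || (move=> ?; subst)) end.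
all: by [].
Qed.

(** The recursion and search rules match on a literal [Node]: [cCons cCar cCdr] turns even the empty
    list into a node, and [cCons cZero cId] starts the search at 0. *)
Fixpoint compile (p : recfun) : tree :=
  match p with
  | RZero => cZero
  | RSucc => cCons cZero cCar
  | RProj i => iter i (fun c => cComp c cCdr) cCar
  | RComp g hs => cComp (compile g) (foldr (fun h => cCons (compile h)) cZero hs)
  | RPrec g h => cComp (cPrec (compile g) (compile h)) (cCons cCar cCdr)
  | RMin g => cComp (cMin (compile g)) (cCons cZero cId)
  end.

Lemma ev_car v : ev cCar (tseq v) (tnat (head 0 v)).
Proof. by case: v => [|x v]; constructor. Qed.

Lemma ev_cdr v : ev cCdr (tseq v) (tseq (behead v)).
Proof. by case: v => [|x v]; constructor. Qed.

Lemma ev_compile p v y : rec_eval p v y -> ev (compile p) (tseq v) (tnat y).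
Proof.
move: p v y; fix IH 1 => -[||i|g hs|g h|g] v y /=.
- by move=> ->; constructor.
- by move=> ->; rewrite nth0; constructor; [constructor|exact: ev_car].
- move=> ->; elim: i v => [|i IHi] v /=; first by rewrite nth0; exact: ev_car.
  by rewrite -nth_behead; apply: EvComp (ev_cdr v) (IHi _).
- move=> [w hw /IH]; apply: EvComp.
  elim: hs w hw => [|h hs IHhs] [|x w] //=; first by constructor.
  by move=> [/IH hx /IHhs]; apply: EvCons.
- move=> e; apply: EvComp (EvCons (ev_car v) (ev_cdr v)) _.
  elim: (head 0 v) y e => [|m IHm] y; first by move=> /IH; constructor.
  by move=> [z /IHm hz /IH]; apply: EvPrecS hz.
- move=> [/IH gy lt_y]; apply: EvComp (EvCons (EvZero _) (EvId _)) _.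
  (* A search from z rests on the search from z + 1, so the induction is on the distance to y. *)
  suff: forall d z, z + d = y ->
      ev (cMin (compile g)) (Node (tnat z) (tseq v)) (tnat y).
    by move=> /(_ y 0); apply.
  elim=> [|d IHd] z zy; first by rewrite -zy addn0 in gy *; exact: EvMin0.
  have [|w /IH gz] := lt_y z; first by rewrite -zy addnS ltnS leq_addr.
  by apply: EvMinS gz _; apply: (IHd z.+1); rewrite addSnnS.
Qed.

(** Negation of truth values: minimization looks for 0, whereas a true relation has value 1. *)
Definition isz := RPrec (RComp RSucc [:: RZero]) RZero.

Lemma Sigma01_ev (A : set nat) : Sigma01 A ->
  exists c, forall x, A x <-> exists u, ev c (Node Leaf (tseq [:: x])) u.
Proof.
move=> [r [p hp] hA].
(* The search variable comes first in the argument list, hence the swapped projections. *)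
pose g := RComp isz [:: RComp p [:: RProj 1; RProj 0]].
have hg x y : ev (compile g) (Node (tnat y) (tseq [:: x])) (tnat (~~ r x y)).
  apply: (@ev_compile g [:: y; x]); exists [:: r x y : nat].
    by split=> //; exists [:: x; y].
  rewrite /isz /=; case: (r x y) => /=; last by exists [:: 0].
  by exists 1 => //; exists [:: 0].
exists (cMin (compile g)) => x; rewrite hA; split.
- move=> [y rxy].
  suff: forall d z, z + d = y ->
      exists u, ev (cMin (compile g)) (Node (tnat z) (tseq [:: x])) u.
    by move=> /(_ y 0); apply.
  elim=> [|d IHd] z zy; have := hg x z.
    by rewrite -zy addn0 in rxy; rewrite rxy; exists (tnat z); exact: EvMin0.
  case: (r x z) => gz; first by exists (tnat z); exact: EvMin0.
  by have [|u hu] := IHd z.+1; [rewrite addSnnS|exists u; exact: EvMinS gz _].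
(* The derivation is followed upwards from z until it ends with [EvMin0]; there the test has value
   0, and determinism of [ev] turns this into r x z. *)
- move=> [u eu]; suff: forall c w u', ev c w u' -> forall z,
      c = cMin (compile g) -> w = Node (tnat z) (tseq [:: x]) -> exists y, r x y.
    by move=> /(_ _ _ _ eu 0); apply.
  move=> {u eu} c w u; elim; try by (intros; discriminate).
    move=> f m v fm _ z [ef] [em ev]; rewrite ef em ev in fm; exists z.
    by have := ev_functional fm (hg x z); case: (r x z).
  by move=> f m v a b _ _ _ IHe z ef [em ev]; apply: (IHe z.+1); rewrite ?em ?ev.
Qed.

(** * Computability of formula contexts *)

Lemma computable_ext f g : f =1 g -> computable f -> computable g.
Proof. by move=> fg [p hp]; exists p => x; rewrite -fg. Qed.

Lemma computable_comp f g : computable f -> computable g -> computable (g \o f).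
Proof.
move=> [p hp] [q hq]; exists (RComp q [:: p]) => x /=.
by exists [:: f x].
Qed.

Definition rconst k := iter k (fun p => RComp RSucc [:: p]) RZero.

Lemma rconstP k v : rec_eval (rconst k) v k.
Proof. by elim: k => // k IHk /=; exists [:: k]. Qed.

Lemma computable_iter f k : computable f -> computable (fun m => iter m f k).
Proof.
move=> [p hp]; exists (RPrec (rconst k) (RComp p [:: RProj 1])) => x.
elim: x => [|x IHx]; first exact: rconstP.
by exists (iter x f k) => //; exists [:: iter x f k] => //; apply: hp.
Qed.

Lemma computable_succ : computable succn.
Proof. by exists RSucc. Qed.

Lemma computable_id : computable id.
Proof. by exists (RProj 0). Qed.

Lemma computable_affine a b : computable (fun y => a * y + b).
Proof.
have hadd : computable (addn a).
  elim: a => [|a IHa]; first exact: computable_id.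
  exact: computable_comp IHa computable_succ.
apply: computable_ext (computable_iter b hadd) => y.
by elim: y => [|y IHy] /=; rewrite ?IHy; lia.
Qed.

Lemma computable_exp2 : computable (expn 2).
Proof.
apply: computable_ext (computable_iter 1 (computable_affine 2 0)) => y.
by elim: y => //= y ->; rewrite expnS addn0.
Qed.

Definition computable_context (F : formula -> formula) :=
  exists2 g, computable g & forall phi, godel (F phi) = g (godel phi).

(** List entries are coded as exponents, so a constructor with one varying subformula has a code
    affine in 2 to the power of the code of that subformula. *)
Lemma context_affine a b F : (forall phi, godel (F phi) = a * 2 ^ godel phi + b) ->
  computable_context F.
Proof.
move=> hF; exists (fun y => a * 2 ^ y + b) => //.
exact: computable_comp computable_exp2 (computable_affine a b).
Qed.

Lemma context_comp F G : computable_context F -> computable_context G ->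
  computable_context (fun phi => G (F phi)).
Proof.
move=> [f cf hf] [g cg hg]; exists (g \o f); first exact: computable_comp.
by move=> phi; rewrite hg hf.
Qed.

Lemma context_id : computable_context id.
Proof. by exists id => //; exact: computable_id. Qed.

Lemma context_Neg F : computable_context F ->
  computable_context (fun phi => Neg (F phi)).
Proof.
move=> hF; apply: (context_comp (G := Neg) hF).
by apply: (@context_affine 16 8) => phi /=; lia.
Qed.

Lemma context_Ex i F : computable_context F ->
  computable_context (fun phi => Ex i (F phi)).
Proof.
move=> hF; apply: (context_comp (G := Ex i) hF).
by apply: (@context_affine (2 ^ 7 * 2 ^ i) (2 ^ 6 * 2 ^ i + 2 ^ 5)) => phi /=; lia.
Qed.

Lemma context_Andl psi F : computable_context F ->
  computable_context (fun phi => And (F phi) psi).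
Proof.
move=> hF; apply: (context_comp (G := fun f => And f psi) hF); pose c := 2 ^ godel psi.
by apply: (@context_affine (2 ^ 5 * (2 * c + 1)) (2 ^ 4)) => phi /=; rewrite -/c; lia.
Qed.

Lemma context_Andr psi F : computable_context F ->
  computable_context (fun phi => And psi (F phi)).
Proof.
move=> hF; apply: (context_comp (G := And psi) hF); pose c := 2 ^ godel psi.
by apply: (@context_affine (2 ^ 6 * c) (2 ^ 5 * c + 2 ^ 4)) => phi /=; rewrite -/c; lia.
Qed.

(** The input x will enter the sentence only through a numeral, which is an iterated context. *)
Lemma computable_context_iter F G phi : computable_context F ->
  computable_context G -> computable (fun x => godel (G (iter x F phi))).
Proof.
move=> [f cf hf] [g cg hg].
apply: computable_ext (computable_comp (computable_iter (godel phi) cf) cg) => x /=.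
by rewrite hg; congr g; elim: x => //= x ->; rewrite hf.
Qed.

(** * The sentences and their meaning *)

Inductive pat := PVar of nat | PLeaf | PNode of pat & pat.

Fixpoint subst (e : nat -> tree) (p : pat) : tree :=
  match p with
  | PVar i => e i
  | PLeaf => Leaf
  | PNode p q => Node (subst e p) (subst e q)
  end.

Fixpoint pat_below k (p : pat) : bool :=
  match p with
  | PVar i => i < k
  | PLeaf => true
  | PNode p q => pat_below k p && pat_below k q
  end.

Fixpoint quote (t : tree) : pat :=
  if t is Node a b then PNode (quote a) (quote b) else PLeaf.

Lemma subst_quote e t : subst e (quote t) = t.
Proof. by elim: t => //= a -> b ->. Qed.

Lemma quote_below k t : pat_below k (quote t).
Proof. by elim: t => //= a -> b ->. Qed.

Definition fact c v u := Node c (Node v u).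
Definition pfact c v u := PNode c (PNode v u).

Definition rule := (seq pat * pat)%type.

(** The constructors of [ev], in the same order, as data from which formulas are generated. *)
Definition ev_rules : seq rule :=
  let: (f, g, v, a, b, m) := (PVar 0, PVar 1, PVar 2, PVar 3, PVar 4, PVar 5) in
  let tag k := PNode (quote (tnat k)) in
  let S := PNode PLeaf in
  [:: ([::], pfact (quote cZero) v PLeaf);
      ([::], pfact (quote cId) v v);
      ([::], pfact (quote cCar) PLeaf PLeaf);
      ([::], pfact (quote cCar) (PNode a b) a);
      ([::], pfact (quote cCdr) PLeaf PLeaf);
      ([::], pfact (quote cCdr) (PNode a b) b);
      ([:: pfact f v a; pfact g v b], pfact (tag 4 (PNode f g)) v (PNode a b));
      ([:: pfact g v a; pfact f a b], pfact (tag 5 (PNode f g)) v b);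
      ([:: pfact f v a], pfact (tag 6 (PNode f g)) (PNode PLeaf v) a);
      ([:: pfact (tag 6 (PNode f g)) (PNode m v) a; pfact g (PNode m (PNode a v)) b],
        pfact (tag 6 (PNode f g)) (PNode (S m) v) b);
      ([:: pfact f (PNode m v) PLeaf], pfact (tag 7 f) (PNode m v) m);
      ([:: pfact f (PNode m v) (S a); pfact (tag 7 f) (PNode (S m) v) b],
        pfact (tag 7 f) (PNode m v) b)].

Definition obeys (T : tree -> Prop) (r : rule) := forall e : nat -> tree,
  List.Forall (fun p => T (subst e p)) r.1 -> T (subst e r.2).

Definition ev_fact (t : tree) := exists c v u, t = fact c v u /\ ev c v u.

Lemma ev_factE c v u : ev_fact (fact c v u) <-> ev c v u.
Proof.
by split=> [[_ [_ [_ [[<- <- <-] h]]]] //|h]; exists c, v, u.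
Qed.

Lemma ev_fact_obeys : List.Forall (obeys ev_fact) ev_rules.
Proof.
repeat apply: List.Forall_cons => //; try exact: List.Forall_nil.
all: move=> e /=; rewrite ?List.Forall_cons_iff => h; apply/ev_factE.
all: try solve [constructor].
all: move: h => [/ev_factE h1]; rewrite ?List.Forall_cons_iff.
- by move=> [/ev_factE h2 _]; exact: EvCons.
- by move=> [/ev_factE h2 _]; exact: EvComp h1 h2.
- by move=> _; exact: EvPrec0.
- by move=> [/ev_factE h2 _]; exact: EvPrecS h1 h2.
- by move=> _; exact: EvMin0.
- by move=> [/ev_factE h2 _]; exact: EvMinS h1 h2.
Qed.

Lemma obeys_ev (T : tree -> Prop) c v u :
  List.Forall (obeys T) ev_rules -> ev c v u -> T (fact c v u).
Proof.
rewrite !List.Forall_cons_iff.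
move=> [h1 [h2 [h3 [h4 [h5 [h6 [h7 [h8 [h9 [h10 [h11 [h12 _]]]]]]]]]]]].
elim=> {c v u}.
- by move=> v; apply: (h1 (fun=> v)); constructor.
- by move=> v; apply: (h2 (fun=> v)); constructor.
- by apply: (h3 (fun=> Leaf)); constructor.
(* The list holds f, g, v, a, b, m in this order; [Leaf] fills the places of variables absent from
   the rule. *)
- by move=> a b; apply: (h4 (nth Leaf [:: Leaf; Leaf; Leaf; a; b])); constructor.
- by apply: (h5 (fun=> Leaf)); constructor.
- by move=> a b; apply: (h6 (nth Leaf [:: Leaf; Leaf; Leaf; a; b])); constructor.
- move=> f g v a b _ ? _ ?; apply: (h7 (nth Leaf [:: f; g; v; a; b])).
  by repeat constructor.
- move=> f g v a b _ ? _ ?; apply: (h8 (nth Leaf [:: f; g; v; a; b])).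
  by repeat constructor.
- move=> f g v a _ ?; apply: (h9 (nth Leaf [:: f; g; v; a])).
  by repeat constructor.
- move=> f g m v a b _ ? _ ?; apply: (h10 (nth Leaf [:: f; g; v; a; b; m])).
  by repeat constructor.
- move=> f m v _ ?; apply: (h11 (nth Leaf [:: f; Leaf; v; Leaf; Leaf; m])).
  by repeat constructor.
- move=> f m v a b _ ? _ ?; apply: (h12 (nth Leaf [:: f; Leaf; v; a; b; m])).
  by repeat constructor.
Qed.

(** * Trees inside a structure *)

Section Interpretation.
Variable M : structure.
Implicit Types (o x y z : domain M) (env : nat -> domain M).

(** Here and in [tagged], [dom] and [pairs], conjunctions are nested as in the formulas below, so
    that satisfaction unfolds to these predicates by conversion. *)
Definition sbeta x y z := beta_of x y z /\ (x <> y /\ y <> z).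

Definition tagged o x := exists k, pred_of k /\ sbeta x k o.

Definition dom o x := pred_of x /\ tagged o x.

Definition pairs o1 o2 x y z := exists k l, (pred_of k /\ pred_of l) /\
  (pred_of z /\ (sbeta x k o1 /\ (sbeta y l o2 /\ sbeta k z l))).

Fixpoint denotes o1 o2 nil env (p : pat) x : Prop :=
  match p with
  | PVar i => x = env i
  | PLeaf => x = nil
  | PNode p q => exists y z, pairs o1 o2 y z x /\
      (denotes o1 o2 nil env p y /\ denotes o1 o2 nil env q z)
  end.

(** An arbitrary P may offer several points for one pair of trees; choice fixes one of them, and h
    need not be injective. *)
Lemma interpretation_exists o1 o2 nil : dom o1 nil ->
  (forall x y, dom o1 x -> dom o1 y -> exists z, dom o1 z /\ pairs o1 o2 x y z) ->
  exists h : tree -> domain M, [/\ h Leaf = nil, forall t, dom o1 (h t) &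
    forall a b, pairs o1 o2 (h a) (h b) (h (Node a b))].
Proof.
move=> dn total.
have /choice[f fP] xy : exists z, dom o1 xy.1 -> dom o1 xy.2 ->
    dom o1 z /\ pairs o1 o2 xy.1 xy.2 z.
  have [[dx dy]|no] := pselect (dom o1 xy.1 /\ dom o1 xy.2).
    by have [z hz] := total _ _ dx dy; exists z.
  by exists nil => dx dy; case: no.
pose h := fix h t := if t is Node a b then f (h a, h b) else nil.
have dh t : dom o1 (h t).
  by elim: t => //= a da b db; have [] := fP (h a, h b) da db.
by exists h; split=> // a b; have [] := fP (h a, h b) (dh a) (dh b).
Qed.

Lemma denotes_subst o1 o2 nil (h : tree -> domain M) env e k p : h Leaf = nil ->
  (forall a b, pairs o1 o2 (h a) (h b) (h (Node a b))) ->
  (forall i, i < k -> env i = h (e i)) -> pat_below k p ->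
  denotes o1 o2 nil env p (h (subst e p)).
Proof.
move=> hL hN he; elim: p => //= [i /he ->//|p IHp q IHq /andP[wp wq]].
by exists (h (subst e p)), (h (subst e q)); auto.
Qed.

Lemma denotes_unique o1 o2 nil (h : tree -> domain M) env e k p x : h Leaf = nil ->
  (forall a b z, pairs o1 o2 (h a) (h b) z -> z = h (Node a b)) ->
  (forall i, i < k -> env i = h (e i)) -> pat_below k p ->
  denotes o1 o2 nil env p x -> x = h (subst e p).
Proof.
move=> hL hN he; elim: p x => //= [i x /he <-//|x _ ->//|p IHp q IHq x /andP[wp wq]].
by move=> [y [z [hx [/(IHp _ wp) yE /(IHq _ wq) zE]]]]; subst; exact: hN.
Qed.

End Interpretation.

Definition bigAnd := foldr And (Eq 0 0).
Definition exs (l : seq nat) phi := foldr Ex phi l.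

Lemma sat_bigAnd (M : structure) (a : nat -> domain M) phis :
  sat a (bigAnd phis) <-> List.Forall (sat a) phis.
Proof.
elim: phis => [|phi phis IH] /=; first by split=> // _; exact: List.Forall_nil.
by rewrite IH List.Forall_cons_iff.
Qed.

Lemma sat_exs (M : structure) (a : nat -> domain M) l phi :
  sat a (exs l phi) <-> exists2 b, (forall i, i \notin l -> b i = a i) & sat b phi.
Proof.
elim: l a => [|i l IH] a /=.
  split=> [h|[b ba]]; first by exists a.
  by have -> : b = a by apply/funext=> j; exact: ba.
split=> [[d /IH[b ba h]]|[b ba h]].
  by exists b => // j; rewrite inE negb_or => /andP[/negbTE ji /ba ->]; rewrite ji.
exists (b i); apply/IH; exists b => // j jl; case: eqP => [->//|/eqP/negbTE ji].
by rewrite ba// inE ji.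
Qed.

(* In the formulas below the variables 0, 1, 2 stand for the three tag points, 3
   for the leaf and 4 for the value of a pattern; the variable i of a pattern is
   i + 10, and 5 to 9 are bound locally. *)
Definition sbetaF i j k := And (Beta i j k) (And (Neg (Eq i j)) (Neg (Eq j k))).
Definition taggedF o i := Ex 9 (And (Pred 9) (sbetaF i 9 o)).
Definition domF i := And (Pred i) (taggedF 0 i).
Definition pairsF i j k := Ex 7 (Ex 8 (And (And (Pred 7) (Pred 8))
  (And (Pred k) (And (sbetaF i 7 0) (And (sbetaF j 8 1) (sbetaF 7 k 8)))))).

(** Both subformulas speak of variable 4, which is rebound to 5 and then to 6 instead of being
    renamed. The stock of variables thus stays finite, and nesting is iteration of a context. *)
Definition nodeF phi psi := Ex 5 (Ex 6 (And (pairsF 5 6 4)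
  (And (Ex 4 (And (Eq 4 5) phi)) (Ex 4 (And (Eq 4 6) psi))))).

Fixpoint denotesF (p : pat) : formula :=
  match p with
  | PVar i => Eq 4 i.+4.+4.+2
  | PLeaf => Eq 4 3
  | PNode p q => nodeF (denotesF p) (denotesF q)
  end.

Definition provedF p := Ex 4 (And (denotesF p) (taggedF 2 4)).

Definition totalF := Neg (Ex 5 (Ex 6 (And (And (domF 5) (domF 6))
  (Neg (Ex 4 (And (domF 4) (pairsF 5 6 4))))))).

(** A premise needs one marked value, while the conclusion must be marked at all its values; the two
    differ where pairing is multivalued. *)
Definition ruleF (r : rule) := Neg (exs (iota 10 6) (And
  (bigAnd [seq domF i | i <- iota 10 6]) (And (bigAnd [seq provedF p | p <- r.1])
  (Ex 4 (And (denotesF r.2) (Neg (taggedF 2 4))))))).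

Definition axiomsF := And (domF 3) (And totalF (bigAnd [seq ruleF r | r <- ev_rules])).

Definition goal_pat c :=
  pfact (quote c) (PNode PLeaf (PNode (PVar 1) PLeaf)) (PVar 0).

(** [inputF] describes variable 11, which is pattern variable 1, so that the numeral for x occurs in
    one place only. *)
Definition goalF c inputF := Ex 11 (And (Ex 4 (And (Eq 4 11) inputF))
  (Ex 10 (And (domF 10) (provedF (goal_pat c))))).

Definition sentF c inputF :=
  Neg (exs (iota 0 16) (And axiomsF (Neg (goalF c inputF)))).

Definition pnat x := iter x (PNode PLeaf) PLeaf.

Lemma quote_tnat x : quote (tnat x) = pnat x.
Proof. by elim: x => //= x ->. Qed.

Definition haltF c x := sentF c (denotesF (pnat x)).

(** * Satisfaction of the formulas *)

Section Satisfaction.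
Variable M : structure.
Implicit Types (a b : nat -> domain M).

Lemma sat_denotesF a p :
  sat a (denotesF p) <-> denotes (a 0) (a 1) (a 3) (fun i => a i.+4.+4.+2) p (a 4).
Proof.
elim: p a => //= p IHp q IHq a; split.
- move=> [y [z [hx [[y' [/= yE /IHp hy]] [z' [/= zE /IHq hz]]]]]]; exists y, z.
  by move: hy hz => /=; rewrite yE zE.
- move=> [y [z [hx [hy hz]]]]; exists y, z; split; first exact: hx.
  by split; [exists y|exists z]; split=> //; [apply/IHp|apply/IHq].
Qed.

Lemma sat_provedF a p : sat a (provedF p) <-> exists2 x,
  denotes (a 0) (a 1) (a 3) (fun i => a i.+4.+4.+2) p x & tagged (a 2) x.
Proof.
split=> [[x [/sat_denotesF hx hy]]|[x hx hy]]; first by exists x.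
by exists x; split=> //; apply/sat_denotesF.
Qed.

Lemma sat_totalF a : sat a totalF <-> forall x y, dom (a 0) x -> dom (a 0) y ->
  exists z, dom (a 0) z /\ pairs (a 0) (a 1) x y z.
Proof.
split=> [h x y dx dy|h [x [y [[dx dy]]]]]; last by apply; exact: h.
by apply: contrapT => no; apply: h; exists x, y; split.
Qed.

Definition pat_closed a r := forall b, (forall i, i \notin iota 10 6 -> b i = a i) ->
  (forall i, i < 6 -> dom (b 0) (b i.+4.+4.+2)) ->
  List.Forall (fun p => sat b (provedF p)) r.1 ->
  forall x, denotes (b 0) (b 1) (b 3) (fun i => b i.+4.+4.+2) r.2 x -> tagged (b 2) x.

Lemma sat_ruleF a r : sat a (ruleF r) <-> pat_closed a r.
Proof.
have domsE b : sat b (bigAnd [seq domF i | i <- iota 10 6]) <->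
    forall i, i < 6 -> dom (b 0) (b i.+4.+4.+2).
  rewrite sat_bigAnd; split; last first.
    by move=> h; do 6?[apply: List.Forall_cons]; [exact: (h 0)|exact: (h 1)|
      exact: (h 2)|exact: (h 3)|exact: (h 4)|exact: (h 5)|exact: List.Forall_nil].
  rewrite !List.Forall_cons_iff => -[h0 [h1 [h2 [h3 [h4 [h5 _]]]]]].
  by do 6?[case=> //].
rewrite /ruleF; set phi := And _ _; rewrite -[sat _ _]/(~ sat a (exs (iota 10 6) phi)).
rewrite sat_exs; split=> [h b ba db pb x hx|h].
  apply: contrapT => nx; apply: h; exists b => //; split.
    exact/domsE.
  split; first by apply/sat_bigAnd/List.Forall_map.
  by exists x; split=> //; apply/sat_denotesF.
move=> [b ba [/domsE db [/sat_bigAnd pb [x [/sat_denotesF hx]]]]].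
apply; apply: (h b ba db _ x) => //.
by move/List.Forall_map: pb.
Qed.

Lemma sat_goalF a c x : sat a (goalF c (denotesF (pnat x))) <-> exists y,
  denotes (a 0) (a 1) (a 3) (fun i => if i == 1 then y else a i.+4.+4.+2) (pnat x) y /\
  exists z, dom (a 0) z /\ exists2 t, denotes (a 0) (a 1) (a 3)
    (fun i => if i == 0 then z else if i == 1 then y else a i.+4.+4.+2) (goal_pat c) t &
    tagged (a 2) t.
Proof.
split=> [[y [[w [/= wE /sat_denotesF hy]] [z [dz hz]]]]|[y [hy [z [dz hz]]]]].
  exists y; split; [by move: hy; rewrite /= wE|exists z; split=> //].
  exact: (sat_provedF _ (goal_pat c)).1 hz.
exists y; split; last by exists z; split=> //; apply/sat_provedF.
by exists y; split=> //; apply/sat_denotesF.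
Qed.

Lemma sat_axiomsF a : sat a axiomsF <-> [/\ dom (a 0) (a 3),
  forall x y, dom (a 0) x -> dom (a 0) y ->
    exists z, dom (a 0) z /\ pairs (a 0) (a 1) x y z &
  List.Forall (pat_closed a) ev_rules].
Proof.
have rulesE rs : sat a (bigAnd [seq ruleF r | r <- rs]) <->
    List.Forall (pat_closed a) rs.
  elim: rs => [|r rs IH]; first by split=> // _; exact: List.Forall_nil.
  rewrite List.Forall_cons_iff -IH -sat_ruleF; exact: iff_refl.
split=> [[h1 [h2 h3]]|[h1 h2 h3]].
  split; [exact: h1|exact: (sat_totalF a).1 h2|exact: (rulesE ev_rules).1 h3].
split; [exact: h1|split; [exact: (sat_totalF a).2 h2|exact: (rulesE ev_rules).2 h3]].
Qed.

Lemma sat_haltF a c x : sat a (haltF c x) <->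
  forall b, (forall i, i \notin iota 0 16 -> b i = a i) ->
  sat b axiomsF -> sat b (goalF c (denotesF (pnat x))).
Proof.
rewrite /haltF /sentF; set phi := And _ _.
rewrite -[sat _ _]/(~ sat a (exs (iota 0 16) phi)) sat_exs.
split=> [h b ba hb|h [b ba [hb]]]; last by apply; exact: h.
by apply: contrapT => nb; apply: h; exists b => //; split.
Qed.

End Satisfaction.

(** * Closedness, computability and truth of the sentences *)

Lemma sentence_haltF c x : sentence (haltF c x).
Proof.
have fv_exs l phi : free_vars (exs l phi) = [seq i <- free_vars phi | i \notin l].
  elim: l => [|i l IH] /=; first by rewrite filter_predT.
  rewrite IH -filter_predI; apply: eq_filter => j.
  by rewrite inE negb_or.
(* The quantifier prefix binds the variables 0 to 15, so a bound on all free variables suffices. *)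
pose bounded phi := all (fun i => i < 16) (free_vars phi).
have bAnd phi psi : bounded phi -> bounded psi -> bounded (And phi psi).
  by rewrite /bounded /= all_cat => -> ->.
have bEx i phi : bounded phi -> bounded (Ex i phi).
  by move=> /allP h; apply/allP=> j /=; rewrite mem_filter => /andP[_ /h].
have bNeg phi : bounded phi -> bounded (Neg phi) by [].
have bnode phi psi : bounded phi -> bounded psi -> bounded (nodeF phi psi).
  by move=> h1 h2; do 2!apply/bEx; apply/bAnd => //; apply/bAnd; apply/bEx; apply/bAnd.
have bden p : pat_below 6 p -> bounded (denotesF p).
  elim: p => [i|//|p IHp q IHq /andP[/IHp hp /IHq hq]]; last exact: bnode.
  by rewrite /bounded /= andbT.
have b6 k p : k <= 6 -> pat_below k p -> pat_below 6 p.
  move=> k6; elim: p => //= [i ik|p IHp q IHq /andP[/IHp -> /IHq ->]//].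
  exact: leq_trans k6.
rewrite /sentence /haltF /sentF; set psi := And _ _.
rewrite -[free_vars _]/(free_vars (exs (iota 0 16) psi)) fv_exs.
suff: bounded psi.
  move=> /allP h; rewrite -(filter_pred0 (free_vars psi)).
  by apply: eq_in_filter => i /h ilt; rewrite mem_iota ilt.
apply/bAnd; first by vm_compute.
apply/bNeg/bEx/bAnd.
  apply/bEx; apply/bAnd => //; apply/bden; rewrite -quote_tnat; exact: quote_below.
apply/bEx; apply/bAnd => //; apply/bEx; apply/bAnd => //; apply/bden.
by rewrite /= quote_below.
Qed.

Lemma computable_haltF c : computable (fun x => godel (haltF c x)).
Proof.
(* [denotesF (pnat x)] arises from [Eq 4 3], the formula of the leaf, by x applications of
   [nodeF (Eq 4 3)]. *)
apply: computable_ext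
  (@computable_context_iter (nodeF (Eq 4 3)) (sentF c) (Eq 4 3) _ _).
- by move=> x; congr (godel (sentF c _)); elim: x => //= x ->.
- do 2!apply: context_Ex; do 2!apply: context_Andr.
  by apply: context_Ex; apply: context_Andr; exact: context_id.
- apply: context_Neg; rewrite /exs.
  elim: (iota 0 16) => [|i l IH]; last exact: context_Ex.
  apply: context_Andr; apply: context_Neg; apply: context_Ex; apply: context_Andl.
  by apply: context_Ex; apply: context_Andr; exact: context_id.
Qed.

(** For any P, the trees whose image under h is marked obey the rules, hence include every derivable
    statement. *)
Lemma haltF_true (M : structure) c x u : ev c (Node Leaf (tseq [:: x])) u ->
  models M (haltF c x).
Proof.
move=> cxu a; apply/sat_haltF => b _ /sat_axiomsF[dn total rules].
have [h [hL hd hN]] := interpretation_exists dn total.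
have /obeys_ev/(_ cxu) goal :
    List.Forall (obeys (fun t => tagged (b 2) (h t))) ev_rules.
  have : all (fun r : rule => all (pat_below 6) (r.2 :: r.1)) ev_rules by [].
  elim: rules => [|r rs hr _ IH] /=; first by constructor.
  move=> /andP[/andP[w2 w1] /IH{}IH]; constructor=> // e prem.
  (* The six pattern variables take the images of e; all others keep their values. *)
  pose b' i := if i \in iota 10 6 then h (e (i - 10)) else b i.
  have b'E i : i < 6 -> b' i.+4.+4.+2 = h (e i).
    by move=> i6; rewrite /b' ifT ?mem_iota // !subSS subn0.
  apply: (hr b').
  - by move=> i /negbTE il; rewrite /b' il.
  - by move=> i i6; rewrite b'E.
  - move: prem w1; elim: r.1 => [|p ps IHps] /=; first by constructor.
    rewrite !List.Forall_cons_iff => -[hp /IHps{}IHps] /andP[wp /IHps].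
    split=> //; apply/sat_provedF; exists (h (subst e p)) => //.
    exact: denotes_subst b'E wp.
  - exact: denotes_subst b'E w2.
apply/sat_goalF; exists (h (tnat x)); split.
  rewrite -{2}(subst_quote (fun=> Leaf) (tnat x)) quote_tnat.
  by apply: (denotes_subst (k := 0)); rewrite // -quote_tnat quote_below.
exists (h u); split=> //; exists (h (fact c (Node Leaf (tseq [:: x])) u)) => //.
rewrite -[fact _ _ _]/(fact c (Node Leaf (Node (tnat x) Leaf)) u).
have -> : fact c (Node Leaf (Node (tnat x) Leaf)) u =
    subst (nth Leaf [:: u; tnat x]) (goal_pat c) by rewrite /= subst_quote.
apply: (denotes_subst (k := 2)) => //; first by case=> [|[]].
by rewrite /= quote_below.
Qed.

(** The hypotheses describe the intended P. The axioms hold there because derivable statements obey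
    the rules, so the sentence yields a marked goal, that is, a derivation. *)
Lemma haltF_false (M : structure) (o1 o2 o3 : domain M) (h : tree -> domain M) c x :
  (forall y, dom o1 y <-> exists t, y = h t) ->
  (forall a b y, pairs o1 o2 (h a) (h b) y <-> y = h (Node a b)) ->
  (forall t, tagged o3 (h t) <-> ev_fact t) ->
  models M (haltF c x) -> exists u, ev c (Node Leaf (tseq [:: x])) u.
Proof.
move=> hd hp ht.
have hN a b y : pairs o1 o2 (h a) (h b) y -> y = h (Node a b) by move/hp.
move=> /(_ (nth o1 [:: o1; o2; o3; h Leaf]))/sat_haltF/(_ _ (fun _ _ => erefl)).
set a := nth _ _; have /[swap]/[apply] : sat a axiomsF.
  apply/sat_axiomsF; split; first by apply/hd; exists Leaf.
  - move=> y z /hd[s ->] /hd[t ->]; exists (h (Node s t)).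
    by split; [apply/hd; exists (Node s t)|apply/hp].
  have : all (fun r : rule => all (pat_below 6) (r.2 :: r.1)) ev_rules by [].
  elim: ev_fact_obeys => [|r rs hr _ IH] /=; first by constructor.
  move=> /andP[/andP[w2 w1] /IH{}IH]; constructor=> // b ba bd prem y.
  have [b0 b1 b2 b3] : [/\ b 0 = o1, b 1 = o2, b 2 = o3 & b 3 = h Leaf] by rewrite !ba.
  have /choice[e he] i : exists t, i < 6 -> b i.+4.+4.+2 = h t.
    have [i6|] := boolP (i < 6); last by exists Leaf.
    by have := bd i i6; rewrite b0 => /hd[t it]; exists t.
  rewrite b0 b1 b2 b3 => /(denotes_unique (erefl _) hN he w2) ->; apply/ht/hr.
  move: prem w1; elim: r.1 => [|p ps IHps] /=; first by constructor.
  rewrite !List.Forall_cons_iff => -[/sat_provedF[z]] + + /IHps{}IHps /andP[wp /IHps].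
  rewrite b0 b1 b2 b3 => /(denotes_unique (erefl _) hN he wp) -> /ht.
  by split.
move=> /sat_goalF[y [hy [z [/hd[u ->] [t]]]]].
have -> : y = h (tnat x).
  rewrite -(subst_quote (fun=> Leaf) (tnat x)) quote_tnat.
  apply: (denotes_unique (k := 0)) hy => //.
  by rewrite -quote_tnat quote_below.
move=> /(@denotes_unique _ _ _ _ h _ (nth Leaf [:: u; tnat x]) 2) -> //.
- by rewrite /= subst_quote => /ht/ev_factE; exists u.
- by case=> [|[]].
- by rewrite /= quote_below.
Qed.

(** * Codes of trees as abstract points *)

(* [tri i j k] prescribes that k lies between i and j; [tri_uniq] says that two
   points are collinear with at most one further point. *)
Section Collinear.
Variable (X : Type) (tri : X -> X -> X -> Prop).

Definition tri_line i j k :=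
  [\/ tri i j k \/ tri j i k, tri i k j \/ tri k i j | tri j k i \/ tri k j i].

Record tri_wf (rank : X -> nat) : Prop := TriWf {
  tri_lt : forall i j k, tri i j k ->
    [/\ (rank i < rank k)%N, (rank j < rank k)%N & i <> j];
  tri_uniq : forall i j k l, tri i j k -> tri_line i j l -> l = k;
  tri_inj : forall i j i' j' k, tri i j k -> tri i' j' k -> i = i' /\ j = j' }.

End Collinear.

Inductive node :=
| Tag1 | Tag2 | Tag3 | Val of tree | Lft of tree | Rgt of tree | Prv of tree.

(** For an underivable t the node [Prv t] still gets a point, but lies between no prescribed pair
    and so marks nothing. *)
Inductive middle : node -> node -> node -> Prop :=
| MidLft t : middle (Val t) Tag1 (Lft t)
| MidRgt t : middle (Val t) Tag2 (Rgt t)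
| MidPrv t : ev_fact t -> middle (Val t) Tag3 (Prv t)
| MidVal a b : middle (Lft a) (Rgt b) (Val (Node a b)).

Fixpoint tree_rank (t : tree) : nat :=
  if t is Node a b then CodeSeq.code [:: tree_rank a; tree_rank b] else 0.

Lemma tree_rank_inj : injective tree_rank.
Proof.
have code_inj := can_inj CodeSeq.codeK.
elim=> [|a IHa b IHb] [|c d] // e.
- by have := code_inj [::] [:: tree_rank c; tree_rank d] e.
- by have := code_inj [:: tree_rank a; tree_rank b] [::] e.
- by move: e => /code_inj[/IHa -> /IHb ->].
Qed.

Lemma tree_rank_lt a b :
  tree_rank a < tree_rank (Node a b) /\ tree_rank b < tree_rank (Node a b).
Proof. by have /and3P[] := CodeSeq.ltn_code [:: tree_rank a; tree_rank b]. Qed.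

(** Each tree takes four consecutive ranks after those of the tags, so a node comes later than the
    two nodes it lies between. *)
Definition node_rank (m : node) : nat :=
  match m with
  | Tag1 => 0
  | Tag2 => 1
  | Tag3 => 2
  | Val t => 4 * tree_rank t + 3
  | Lft t => 4 * tree_rank t + 4
  | Rgt t => 4 * tree_rank t + 5
  | Prv t => 4 * tree_rank t + 6
  end.

Lemma node_rank_inj : injective node_rank.
Proof.
by move=> [|||t|t|t|t] [|||t'|t'|t'|t'] /= e; try lia; try by [];
  f_equal; apply: tree_rank_inj; lia.
Qed.

Lemma middle_wf : tri_wf middle node_rank.
Proof.
split.
- move=> i j k [t|t|t _|a b]; try by split=> //=; lia.
  by have [? ?] := tree_rank_lt a b; split=> //; rewrite /node_rank; lia.
- move=> i j k l ijk ijl.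
  by case: ijk ijl => [t|t|t _|a b] [] [] h; inversion h; congruence.
- move=> i j i' j' k ijk; case: ijk => [t|t|t _|a b] h; inversion h; split; congruence.
Qed.

(** Transfer to natural numbers, along which points are chosen recursively; a number that is no rank
    gets an unconstrained point. *)
Definition rank_middle i j k := exists a b c,
  middle a b c /\ [/\ i = node_rank a, j = node_rank b & k = node_rank c].

Lemma rank_middle_wf : tri_wf rank_middle id.
Proof.
have [wlt wuniq winj] := middle_wf; split.
- move=> _ _ _ [a [b [c [/wlt[h1 h2 h3] [-> -> ->]]]]]; split=> //.
  by move/node_rank_inj.
- move=> _ _ _ l [a [b [c [abc [-> -> ->]]]]] h.
  have [d ld abd] : exists2 d, l = node_rank d & tri_line middle a b d.
    case: h => [] [] [a' [b' [c' [h' [e1 e2 e3]]]]];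
      try (move/node_rank_inj: e1 => e1); try (move/node_rank_inj: e2 => e2);
      try (move/node_rank_inj: e3 => e3); subst; eexists=> //;
      solve [by apply: Or31; auto|by apply: Or32; auto|by apply: Or33; auto].
  by rewrite ld (wuniq _ _ _ _ abc abd).
- move=> _ _ i' j' k' [a [b [c [h [-> -> ->]]]]] [a' [b' [c' [h' [-> ->]]]]].
  by move=> /node_rank_inj e; rewrite -e in h'; have [-> ->] := winj _ _ _ _ _ h h'.
Qed.

Import Order.TTheory GRing.Theory Num.Theory.
Local Open Scope ring_scope.

(** * Lines and segments in a linearly regular flat *)

Section Euclid.
Variables (R : realType) (n : nat).
Implicit Types (r : R) (u v s t p q a b : 'rV[R]_n).

Definition dotp u v : R := \sum_(i < n) u ord0 i * v ord0 i.
Definition enorm u : R := Num.sqrt (dotp u u).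

Lemma distE s t : dist s t = enorm (s - t).
Proof. by congr Num.sqrt; apply: eq_bigr => i _; rewrite !mxE expr2. Qed.

Lemma dotp_comb (x y : R) u v :
  dotp (x *: u + y *: v) (x *: u + y *: v)
  = x ^+ 2 * dotp u u + y ^+ 2 * dotp v v + 2 * x * y * dotp u v.
Proof.
rewrite /dotp !mulr_sumr -!big_split /=; apply: eq_bigr => i _.
by rewrite !mxE; ring.
Qed.

Lemma dotp_ge0 u : 0 <= dotp u u.
Proof. by apply: sumr_ge0 => i _; rewrite -expr2 sqr_ge0. Qed.

Lemma dotp_eq0 u : dotp u u = 0 -> u = 0.
Proof.
move=> /psumr_eq0P u0; apply/rowP=> i; rewrite mxE; apply/eqP.
rewrite -sqrf_eq0 expr2 u0 //= => j _.
by rewrite -expr2 sqr_ge0.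
Qed.

Lemma enorm_ge0 u : 0 <= enorm u. Proof. exact: sqrtr_ge0. Qed.

Lemma sqr_enorm u : enorm u ^+ 2 = dotp u u.
Proof. by rewrite sqr_sqrtr ?dotp_ge0. Qed.

Lemma enorm_eq0 u : enorm u = 0 -> u = 0.
Proof. by move=> u0; apply: dotp_eq0; rewrite -sqr_enorm u0 expr0n. Qed.

Lemma enormZ r u : enorm (r *: u) = `|r| * enorm u.
Proof.
have := dotp_comb r 0 u 0; rewrite scaler0 addr0 expr0n /= mul0r mulr0 mul0r !addr0.
by rewrite /enorm => ->; rewrite sqrtrM ?sqr_ge0// sqrtr_sqr.
Qed.

(** Nonnegativity of this square gives the Cauchy-Schwarz inequality, and its vanishing gives the
    equality case of the triangle inequality. *)
Lemma enormB_sqr u v :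
  dotp (enorm v *: u + (- enorm u) *: v) (enorm v *: u + (- enorm u) *: v)
  = 2 * (enorm u * enorm v) * (enorm u * enorm v - dotp u v).
Proof. by rewrite dotp_comb -!sqr_enorm; ring. Qed.

Lemma dotp_le u v : dotp u v <= enorm u * enorm v.
Proof.
have [/enorm_eq0 u0|u0] := eqVneq (enorm u) 0.
  by rewrite u0 /dotp big1 ?mulr_ge0 ?enorm_ge0// => i _; rewrite mxE mul0r.
have [/enorm_eq0 v0|v0] := eqVneq (enorm v) 0.
  by rewrite v0 /dotp big1 ?mulr_ge0 ?enorm_ge0// => i _; rewrite mxE mulr0.
have := dotp_ge0 (enorm v *: u + (- enorm u) *: v).
rewrite enormB_sqr pmulr_rge0 ?subr_ge0// !mulr_gt0// lt_def ?u0 ?v0 enorm_ge0//.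
Qed.

Lemma sqr_enormD u v :
  enorm (u + v) ^+ 2 = enorm u ^+ 2 + enorm v ^+ 2 + 2 * dotp u v.
Proof.
have := dotp_comb 1 1 u v; rewrite !scale1r -!sqr_enorm => ->; ring.
Qed.

Lemma enormD u v : enorm (u + v) <= enorm u + enorm v.
Proof.
rewrite -(ler_pXn2r (n := 2)) ?nnegrE ?addr_ge0 ?enorm_ge0//.
rewrite sqr_enormD; have := dotp_le u v; nra.
Qed.

Lemma enormD_eq u v : enorm (u + v) = enorm u + enorm v ->
  enorm v *: u = enorm u *: v.
Proof.
move=> uv; have := sqr_enormD u v; rewrite uv => e.
have d : enorm u * enorm v - dotp u v = 0 by nra.
have := enormB_sqr u v; rewrite d mulr0 => /dotp_eq0.
by rewrite scaleNr => /eqP; rewrite subr_eq0 => /eqP.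
Qed.

Lemma dist_par s v (x y : R) : dist (s + x *: v) (s + y *: v) = `|x - y| * enorm v.
Proof. by rewrite distE -enormZ; congr enorm; apply/rowP=> i; rewrite !mxE; ring. Qed.

Lemma betw_par s v (x y z : R) : x <= y <= z \/ z <= y <= x ->
  betw (s + x *: v) (s + y *: v) (s + z *: v).
Proof.
rewrite /betw !dist_par -mulrDl => h; congr (_ * _).
case: h => /andP[h1 h2].
- by have h3 := le_trans h1 h2; rewrite !ler0_norm ?subr_le0//; ring.
- by have h3 := le_trans h1 h2; rewrite !ger0_norm ?subr_ge0//; ring.
Qed.

Lemma betwE s t u : betw s t u -> exists r, t = s + r *: (u - s).
Proof.
rewrite /betw !distE => e.
have ab : s - u = (s - t) + (t - u) by rewrite addrA subrK.
rewrite ab in e; have {e ab} := enormD_eq e.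
have := enorm_ge0 (s - t); have := enorm_ge0 (t - u).
have := @enorm_eq0 (s - t).
move: (enorm (s - t)) (enorm (t - u)) => x y x0 y_ge0 x_ge0 h.
have [e0|e0] := eqVneq (x + y) 0.
  exists 0; rewrite scale0r addr0; apply/esym/eqP; rewrite -subr_eq0; apply/eqP.
  by apply: x0; lra.
exists (x / (x + y)); apply/rowP=> i; move/rowP/(_ i): h; rewrite !mxE => h.
apply: (mulfI e0); rewrite mulrDr mulrA mulrCA divff// mulr1; lra.
Qed.

(* [on a a] is the point a alone, so that avoiding all the lines through pairs
   of earlier points includes avoiding these points. *)
Definition on a b c := exists r, c = a + r *: (b - a).

Definition inside a b c := exists2 r, 0 < r < 1 & c = a + r *: (b - a).

Lemma on_l a b : on a b a.
Proof. by exists 0; rewrite scale0r addr0. Qed.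

Lemma on_r a b : on a b b.
Proof. by exists 1; rewrite scale1r addrC subrK. Qed.

Lemma on_eq a b : on a a b -> b = a.
Proof. by move=> [r ->]; rewrite subrr scaler0 addr0. Qed.

Lemma on_comb a b p q r : on a b p -> on a b q -> on a b (p + r *: (q - p)).
Proof.
move=> [x ->] [y ->]; exists (x + r * (y - x)).
by apply/rowP=> i; rewrite !mxE; ring.
Qed.

Lemma on_trans a b p q c : p <> q ->
  on a b p -> on a b q -> on a b c -> on p q c.
Proof.
move=> pq [x px] [y qy] [z cz]; have [xy|xy] := eqVneq x y.
  by case: pq; rewrite px qy xy.
exists ((z - x) / (y - x)); have yx : y - x != 0 by rewrite subr_eq0 eq_sym.
apply/rowP=> i; rewrite cz px qy !mxE.
have -> : a 0 i + y * (b 0 i - a 0 i) - (a 0 i + x * (b 0 i - a 0 i))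
  = (y - x) * (b 0 i - a 0 i) by ring.
by rewrite mulrA divfK//; ring.
Qed.

Lemma on_par a b s t (x y z : R) : x != y ->
  on a b (s + x *: (t - s)) -> on a b (s + y *: (t - s)) ->
  on a b (s + z *: (t - s)).
Proof.
move=> xy hx hy; have := on_comb ((z - x) / (y - x)) hx hy.
congr on; apply/rowP=> i; rewrite !mxE.
have -> : s 0 i + y * (t 0 i - s 0 i) - (s 0 i + x * (t 0 i - s 0 i))
  = (y - x) * (t 0 i - s 0 i) by ring.
by rewrite mulrA divfK ?subr_eq0 1?eq_sym//; ring.
Qed.

Lemma betw_on s t u : s <> t -> betw s t u -> on s t u.
Proof.
move=> st /betwE[r tE]; have [r0|r0] := eqVneq r 0.
  by case: st; rewrite tE r0 scale0r addr0.
exists r^-1; rewrite tE addrAC subrr add0r scalerA mulVf// scale1r.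
by rewrite addrC subrK.
Qed.

Lemma inside_betw s t u : inside s u t -> betw s t u.
Proof.
move=> [r /andP[r0 r1] ->].
have := @betw_par s (u - s) 0 r 1 (or_introl _).
by rewrite scale0r scale1r addr0 (addrC s (u - s)) subrK; apply; rewrite !ltW.
Qed.

Lemma is_line_on (U : set 'rV[R]_n) s t : U s -> U t -> s <> t ->
  is_line_in U [set u | U u /\ on s t u].
Proof.
move=> Us Ut st; split.
- by move=> u [].
- by exists s, t; split=> //; split=> //; [exact: on_l|exact: on_r].
- move=> _ _ _ [_ [x ->]] [_ [y ->]] [_ [z ->]].
  have [xy|yx] := leP x y; have [yz|zy] := leP y z; have [xz|zx] := leP x z.
  + by apply: Or31; apply: betw_par; left; rewrite xy.
  + by apply: Or31; apply: betw_par; left; rewrite xy.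
  + by apply: Or32; apply: betw_par; left; rewrite xz ltW.
  + by apply: Or33; apply: betw_par; right; rewrite xy ltW.
  + by apply: Or33; apply: betw_par; left; rewrite xz ltW.
  + by apply: Or32; apply: betw_par; right; rewrite yz ltW.
  + by apply: Or31; apply: betw_par; right; rewrite !ltW.
  + by apply: Or31; apply: betw_par; right; rewrite !ltW.
- move=> p q u [_ hp] [_ hq] pq Uu [/betwE[r uE]|/(betw_on pq)[r uE]];
  by split=> //; rewrite uE; exact: on_comb.
Qed.

Lemma line_dense (S : set 'rV[R]_n) s t : linearly_complete S ->
  S s -> S t -> s <> t -> forall r (e : R), 0 < e ->
  exists2 r', `|r - r'| < e & S (s + r' *: (t - s)).
Proof.
move=> cS Ss St st r e e0.
have d0 : 0 < enorm (t - s).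
  rewrite lt_def enorm_ge0 andbT; apply/eqP => /enorm_eq0/eqP.
  by rewrite subr_eq0 => /eqP ts; case: st.
have [|||q [Sq [r' qE]]] := cS _ _ (is_line_on Ss St st)
  (@is_line_on setT _ _ I I st) _ (s + r *: (t - s)) _ (e * enorm (t - s)).
- by move=> u [].
- by split=> //; exists r.
- exact: mulr_gt0.
by rewrite qE dist_par ltr_pM2r// => ?; exists r' => //; rewrite -qE.
Qed.

(** A line not containing both s and t meets their line at most once, so it misses one open half of
    any interval of parameters. *)
Lemma avoid_lines s t (l : seq ('rV[R]_n * 'rV[R]_n)) (lo hi : R) :
  (forall ab, ab \in l -> ~ (on ab.1 ab.2 s /\ on ab.1 ab.2 t)) -> lo < hi ->
  exists lo' hi', [/\ lo <= lo', lo' < hi', hi' <= hi & forall r, lo' < r < hi' ->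
    forall ab, ab \in l -> ~ on ab.1 ab.2 (s + r *: (t - s))].
Proof.
elim: l => [|ab l IHl] hl lohi; first by exists lo, hi; split.
have [||lo1 [hi1 [h1 h2 h3 h4]]] := IHl => [cd cdl|//|].
  by apply: hl; rewrite inE cdl orbT.
pose m := (lo1 + hi1) / 2; have [lm mh] : lo1 < m /\ m < hi1 by rewrite /m; lra.
have [[r [lr rm hr]]|no] := pselect (exists r, [/\ lo1 < r, r < m &
    on ab.1 ab.2 (s + r *: (t - s))]); last first.
  exists lo1, m; split=> //; first by lra.
  move=> r /andP[r1 r2] cd; rewrite inE => /orP[/eqP ->|cdl].
    by move=> h; apply: no; exists r.
  by apply: h4 cdl; rewrite r1 (lt_trans r2).
exists m, hi1; split=> //; first by lra.
move=> r' /andP[r1 r2] cd; rewrite inE => /orP[/eqP ->|cdl]; last first.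
  by apply: h4 cdl; rewrite r2 andbT (lt_trans lm).
move=> hr'; apply: (hl ab); first by rewrite inE eqxx.
have rr' : r != r' by apply/eqP => e; lra.
have := on_par 0 rr' hr hr'; have := on_par 1 rr' hr hr'.
by rewrite scale0r scale1r addr0 addrC subrK.
Qed.

Definition off_lines (l : seq ('rV[R]_n * 'rV[R]_n)) p :=
  forall ab, ab \in l -> ~ on ab.1 ab.2 p.

Definition rich_segments (U : set 'rV[R]_n) := forall s t, U s -> U t -> s <> t ->
  forall l, (forall ab, ab \in l -> ~ (on ab.1 ab.2 s /\ on ab.1 ab.2 t)) ->
  exists p, [/\ U p, inside s t p & off_lines l p].

Definition rich (U : set 'rV[R]_n) := forall l, exists2 p, U p & off_lines l p.

(** Density provides a parameter in the subinterval from [avoid_lines], and balls are convex. *)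
Lemma rich_segments_ball (S : set 'rV[R]_n) x e : linearly_complete S ->
  rich_segments [set u | S u /\ dist x u < e].
Proof.
move=> cS s t [Ss xs] [St xt] st l hl.
have [lo [hi [h1 h2 h3 h4]]] := avoid_lines hl ltr01.
have [|r rmid Sr] := line_dense cS Ss St st ((lo + hi) / 2) (e := (hi - lo) / 2).
  by lra.
have /andP[r1 r2] : lo < r < hi by move: rmid; rewrite ltr_norml; lra.
exists (s + r *: (t - s)); split; last by apply: h4; rewrite r1.
- split=> //; move: xs xt; rewrite !distE => xs xt.
  have -> : x - (s + r *: (t - s)) = (1 - r) *: (x - s) + r *: (x - t).
    by apply/rowP=> i; rewrite !mxE; ring.
  have [r0 r3] : 0 < r /\ r < 1 by lra.
  apply: le_lt_trans (enormD _ _) _; rewrite !enormZ !ger0_norm; [|lra..].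
  nra.
- by exists r => //; lra.
Qed.

(** First a point a is chosen between x and s, off all listed lines but the line xs. A listed line
    through a and t would then be xs, which misses t; so the segment from a to t offers a point off
    all listed lines. *)
Lemma rich_noncollinear (U : set 'rV[R]_n) x s t :
  rich_segments U -> U x -> U s -> U t -> x <> s -> ~ on x s t -> rich U.
Proof.
move=> hU Ux Us Ut xs xst l.
pose l1 := [seq ab <- l | ~~ `[< on ab.1 ab.2 x /\ on ab.1 ab.2 s >]].
have [|a [Ua axs al]] := hU _ _ Ux Us xs l1.
  by move=> ab; rewrite mem_filter => /andP[/asboolPn].
have at' : a <> t by case: axs => r _ -> e; apply: xst; exists r.
have [|p [Up _ pl]] := hU _ _ Ua Ut at' l; last by exists p.
move=> ab abl [aba abt]; case: (pselect (on ab.1 ab.2 x /\ on ab.1 ab.2 s)).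
  by move=> [abx abs]; apply: xst; exact: on_trans abx abs abt.
by move=> /asboolPn h; apply: (al ab); rewrite ?mem_filter ?h.
Qed.

(** As S lies in no line, it has points s, t not collinear with x; density moves them towards x into
    the ball along their lines through x. *)
Lemma rich_regular (S : set 'rV[R]_n) x e : (1 <= n)%N -> 0 < e -> S x ->
  linearly_regular_flat 2 S -> rich [set u | S u /\ dist x u < e].
Proof.
move=> n1 e0 Sx [_ _ S1 cS _].
have flat1 s : x <> s -> is_flat 1 [set u | on x s u].
  move=> xs; exists x, [tuple s - x]; split.
    by rewrite seq1_free subr_eq0; apply/eqP => sx; case: xs.
  apply/seteqP; split=> u /=.
    by move=> [r ->]; exists (fun=> r) => //; rewrite big_ord1 (tnth_nth 0).
  by move=> [r _ <-]; rewrite big_ord1 (tnth_nth 0); exists (r ord0).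
have noflat s : x <> s -> exists2 t, S t & ~ on x s t.
  move=> /flat1/(S1 1%N _ erefl); apply: contra_notP => no t St.
  by apply: contrapT => h; apply: no; exists t.
have [s Ss xs] : exists2 s, S s & x <> s.
  (* Some point other than x is required to span a line; it exists because n is positive. *)
  have [|t St xt] := noflat (x + const_mx 1).
    move/rowP/(_ (Ordinal n1)); rewrite !mxE => /eqP.
    by rewrite -subr_eq0 opprD addrA subrr sub0r oppr_eq0 oner_eq0.
  by exists t => // e'; apply: xt; rewrite -e'; exact: on_l.
have [t St xst] := noflat s xs.
have xt : x <> t by move=> xt; apply: xst; rewrite -xt; exact: on_l.
have near u : S u -> x <> u -> exists r, [/\ 0 < r, S (x + r *: (u - x)) &
    dist x (x + r *: (u - x)) < e].
  move=> Su xu; have d0 : 0 < enorm (u - x).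
    rewrite lt_def enorm_ge0 andbT; apply/eqP => /enorm_eq0/eqP.
    by rewrite subr_eq0 => /eqP ux; case: xu.
  have d1 : 0 < e / enorm (u - x) by rewrite divr_gt0.
  have [|r hr Sr] := line_dense cS Sx Su xu (e / enorm (u - x) / 2)
    (e := e / enorm (u - x) / 2); first by lra.
  have /andP[r0 re] : 0 < r < e / enorm (u - x).
    by move: hr; rewrite ltr_norml; move: (e / _) => f; lra.
  exists r; split=> //; have := dist_par x (u - x) 0 r.
  by rewrite scale0r addr0 => ->; rewrite sub0r normrN gtr0_norm// -ltr_pdivlMr.
have [r [r0 Sr re]] := near s Ss xs; have [r' [r'0 Sr' re']] := near t St xt.
apply: (@rich_noncollinear _ x (x + r *: (s - x)) (x + r' *: (t - x))) => //.
- exact: rich_segments_ball.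
- split=> //; have := dist_par x 0 0 0; rewrite !scaler0 addr0 => ->.
  by rewrite subrr normr0 mul0r.
- move/eqP; rewrite eq_sym addrC -subr_eq0 addrK scaler_eq0 gt_eqF//= subr_eq0.
  by move/eqP=> sx; case: xs.
- move=> [c /rowP h]; apply: xst; exists (c * r / r'); apply/rowP=> i.
  move/(_ i): h; rewrite !mxE => h; have r'n : r' != 0 by rewrite gt_eqF.
  apply: (mulfI r'n); rewrite mulrDr mulrA (mulrC r' (_ / _)) divfK//.
  lra.
Qed.

End Euclid.

Section Dist.
Variables (R : realType) (n : nat).
Implicit Types s t : 'rV[R]_n.

Lemma distxx s : dist s s = 0.
Proof. by rewrite distE subrr -(scale0r s) enormZ normr0 mul0r. Qed.

Lemma distC s t : dist s t = dist t s.
Proof. by rewrite !distE -(opprB t s) -scaleN1r enormZ normrN normr1 mul1r. Qed.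

Lemma dist_eq0 s t : dist s t = 0 -> s = t.
Proof.
by rewrite distE => /enorm_eq0/eqP; rewrite subr_eq0 => /eqP.
Qed.

End Dist.

(** * Realization of abstract points *)

Definition sbetw (R : realType) (n : nat) (s t u : 'rV[R]_n) :=
  betw s t u /\ (s <> t /\ t <> u).

Section Placement.
Variables (R : realType) (n : nat) (U : set 'rV[R]_n) (tri : nat -> nat -> nat -> Prop).
Hypotheses (rsU : rich_segments U) (rU : rich U) (wf : tri_wf tri id).

Record placed (q : nat -> 'rV[R]_n) (k : nat) : Prop := Placed {
  placed_in : forall i, (i < k)%N -> U (q i);
  placed_inj : forall i j, (i < k)%N -> (j < k)%N -> q i = q j -> i = j;
  placed_on : forall i j l, (i < k)%N -> (j < k)%N -> (l < k)%N ->
    i <> j -> i <> l -> j <> l -> on (q i) (q j) (q l) -> tri_line tri i j l;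
  placed_inside : forall i j l, (l < k)%N -> tri i j l -> inside (q i) (q j) (q l) }.

Lemma tri_lineC i j k : tri_line tri i j k -> tri_line tri j i k.
Proof.
by case=> h; [apply: Or31|apply: Or33|apply: Or32]; case: h; auto.
Qed.

Lemma tri_lineCr i j k : tri_line tri i j k -> tri_line tri i k j.
Proof.
by case=> h; [apply: Or32|apply: Or31|apply: Or33]; case: h; auto.
Qed.

(** If k is prescribed between i and j, the point is taken on their segment, off every line of
    earlier pairs except theirs. A pair a, b on that line must be i, j, since a third earlier point
    would contradict [tri_uniq]. Otherwise all lines are avoided. *)
Lemma next_point q k : placed q k -> exists p, [/\ U p,
  forall i, (i < k)%N -> q i <> p,
  forall i j, (i < k)%N -> (j < k)%N -> i <> j -> on (q i) (q j) p ->
    tri_line tri i j k &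
  forall i j, tri i j k -> inside (q i) (q j) p].
Proof.
move=> [qU qI qon _].
pose l := [seq (q i, q j) | i <- iota 0 k, j <- iota 0 k].
have in_l i j : (i < k)%N -> (j < k)%N -> (q i, q j) \in l.
  by move=> ik jk; apply/allpairsP; exists (i, j); rewrite !mem_iota.
have [[i [j ijk]]|no] := pselect (exists i j, tri i j k); last first.
  have [p Up pl] := rU l; exists p; split=> //.
  - by move=> i ik qp; apply: (pl _ (in_l i i ik ik)); rewrite /= -qp; exact: on_l.
  - by move=> i j ik jk _ /(pl _ (in_l i j ik jk)).
  - by move=> i j ijk; case: no; exists i, j.
have [ik jk ij] := tri_lt wf ijk.
have qij : q i <> q j by move/qI => /(_ ik jk).
pose l1 := [seq ab <- l | ~~ `[< on ab.1 ab.2 (q i) /\ on ab.1 ab.2 (q j) >]].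
have [|p [Up pij pl]] := rsU (qU i ik) (qU j jk) qij (l := l1).
  by move=> ab; rewrite mem_filter => /andP[/asboolPn].
have both a b : (a < k)%N -> (b < k)%N -> on (q a) (q b) p ->
    on (q a) (q b) (q i) /\ on (q a) (q b) (q j).
  move=> ak bk abp; apply: contrapT => /asboolPn h.
  by apply: (pl (q a, q b)) => //; rewrite mem_filter h in_l.
exists p; split=> //.
- move=> a ak qp; have [|/on_eq ia /on_eq ja] := both a a ak ak.
    by rewrite qp; exact: on_l.
  by apply: qij; rewrite ia ja.
- move=> a b ak bk ab abp; have [abi abj] := both a b ak bk abp.
  have third c : (c < k)%N -> on (q a) (q b) (q c) -> c = i \/ c = j.
    move=> ck abc; apply: contrapT => /not_orP[ci cj].
    have : tri_line tri i j c.
      by apply: qon => //; [exact/nesym|exact/nesym|exact: on_trans qij abi abj abc].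
    by move=> /(tri_uniq wf ijk) e; rewrite e ltnn in ck.
  have [] := third a ak (on_l _ _); have [] := third b bk (on_r _ _);
  by move=> eb ea; subst=> //; apply: Or31; auto.
- by move=> a b abk; have [<- <-] := tri_inj wf ijk abk.
Qed.

Definition update (q : nat -> 'rV[R]_n) k p i := if i == k then p else q i.

Lemma placed_next q k : placed q k -> exists p, placed (update q k p) k.+1.
Proof.
move=> qk; have [p [Up qp pon pin]] := next_point qk; case: qk => qU qI qon qin.
have updk : update q k p k = p by rewrite /update eqxx.
have upd i : (i < k)%N -> update q k p i = q i.
  by move=> ik; rewrite /update ltn_eqF.
have ltE i : (i < k.+1)%N -> i = k \/ (i < k)%N.
  by rewrite ltnS leq_eqVlt => /predU1P.
exists p; split.
- by move=> i /ltE[->|ik]; rewrite ?updk ?upd//; exact: qU.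
- move=> i j /ltE[->|ik] /ltE[->|jk] //.
  + by rewrite updk upd// => /esym/(qp _ jk).
  + by rewrite updk upd// => /(qp _ ik).
  + by rewrite !upd//; exact: qI.
(* The new point may stand at any of the three places; collinearity is permuted to bring it last. *)
- have pon' i j : (i < k)%N -> (j < k)%N -> i <> j -> on (q i) p (q j) ->
      tri_line tri i j k.
    move=> ik jk ij h; apply: pon => //.
    by apply: on_trans h (on_r _ _); [move/qI => /(_ ik jk)|exact: on_l].
  move=> i j l /ltE[->|ik] /ltE[->|jk] /ltE[->|lk] // ij il jl;
    rewrite ?updk ?upd//.
  + move=> h; apply: tri_lineC; apply: tri_lineCr; apply: pon' => //.
    by apply: on_trans h; [exact: qp|exact: on_r|exact: on_l].
  + by move=> h; apply: tri_lineCr; exact: pon'.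
  + exact: pon.
  + exact: qon.
- move=> i j l lk ijl; have [il jl _] := tri_lt wf ijl.
  have [ik jk] : (i < k)%N /\ (j < k)%N by rewrite /= in il jl *; lia.
  rewrite (upd i)// (upd j)//; move: ijl; have [->|{}lk] := ltE _ lk.
    by rewrite updk; exact: pin.
  by rewrite upd//; exact: qin.
Qed.

(** Stage k only sets the value at k, so the stages agree where they are defined and the limit is
    their diagonal. *)
Lemma placed_all : exists q, forall k, placed q k.
Proof.
have /choice[f fP] qk : exists p, placed qk.1 qk.2 ->
    placed (update qk.1 qk.2 p) qk.2.+1.
  have [/placed_next[p hp]|no] := pselect (placed qk.1 qk.2); first by exists p.
  by exists 0.
pose Q := fix Q k := if k is k'.+1 then update (Q k') k' (f (Q k', k')) else fun=> 0.
have QP k : placed (Q k) k by elim: k => [|k IHk]; [split|exact: (fP (Q k, k))].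
have Qst i d : Q (i.+1 + d)%N i = Q i.+1 i.
  elim: d => [|d <-]; rewrite ?addn0// addnS /= {1}/update ifF//.
  by apply/eqP; lia.
exists (fun i => Q i.+1 i) => k.
have QE i : (i < k)%N -> Q i.+1 i = Q k i by move=> ik; rewrite -(subnKC ik) Qst.
have [qU qI qon qin] := QP k; split.
- by move=> i ik; rewrite QE//; exact: qU.
- by move=> i j ik jk; rewrite !QE//; exact: qI.
- by move=> i j l ik jk lk; rewrite !QE//; exact: qon.
- move=> i j l lk ijl; have [il jl _] := tri_lt wf ijl.
  by rewrite !QE//; [exact: qin|exact: ltn_trans lk|exact: ltn_trans lk].
Qed.

Lemma placement : exists q : nat -> 'rV[R]_n, [/\ forall k, U (q k), injective q &
  forall i j k, sbetw (q i) (q k) (q j) <-> tri i j k \/ tri j i k].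
Proof.
have [q qP] := placed_all.
have qI : injective q.
  move=> i j; apply: (placed_inj (qP (maxn i j).+1)); lia.
have qin i j k : tri i j k -> betw (q i) (q k) (q j).
  by move=> h; apply: inside_betw; apply: (placed_inside (qP k.+1)).
have betC s t u : betw s t u -> betw u t s.
  by rewrite /betw (distC u) (distC u t) (distC t s) addrC.
exists q; split=> //; first by move=> k; apply: (placed_in (qP k.+1)).
have tri_ne i j k : tri i j k -> q i <> q k /\ q k <> q j.
  move=> /(tri_lt wf)[ik jk _]; split=> /qI e; first by rewrite e ltnn in ik.
  by rewrite e ltnn in jk.
move=> i j k; split; last first.
  by case=> h; have [h1 h2] := tri_ne _ _ _ h; split; [exact: qin|split|
    exact/betC/qin|split; exact/nesym].
move=> h; have [b [ik kj]] := h.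
have ij : q i <> q j.
  move=> ij; apply: ik; apply: dist_eq0; move: b; rewrite /betw -ij distxx.
  by rewrite (distC _ (q i)); lra.
have := betwE b; rewrite -/(on _ _ _).
have kq : i <> k by move=> e; apply: ik; rewrite e.
have jq : j <> k by move=> e; apply: kj; rewrite e.
have ij' : i <> j by move=> e; apply: ij; rewrite e.
pose M := (maxn i (maxn j k)).+1.
have [iM jM kM] : [/\ (i < M)%N, (j < M)%N & (k < M)%N] by rewrite /M; split; lia.
move=> /(placed_on (qP M) iM jM kM ij' kq jq) [//||].
(* Two different points of a triple cannot each lie between the other two: adding the distance
   equations would make two points coincide. *)
- by case=> /qin b'; exfalso; apply: kj; apply: dist_eq0;
    have := distC (q j) (q k); have := distC (q k) (q i);
    have := distC (q j) (q i); move: b b'; rewrite /betw; lra.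
- by case=> /qin b'; exfalso; apply: ik; apply: dist_eq0;
    have := distC (q j) (q k); have := distC (q k) (q i);
    have := distC (q j) (q i); move: b b'; rewrite /betw; lra.
Qed.

End Placement.

(** * The coding subset of T and the reduction *)

Section Points.
Variables (R : realType) (n : nat) (T : set 'rV[R]_n).

Lemma points_exist : (1 <= n)%N -> extends_linearly_2D T ->
  exists pos : node -> T, injective pos /\ forall a b c,
    sbetw (val (pos a)) (val (pos c)) (val (pos b)) <-> middle a b c \/ middle b a c.
Proof.
move=> n1 [S [e [x [regS e0 [Sx Tx] ST]]]].
have [_ _ _ cS _] := regS.
have [q [qU qI qP]] := placement (@rich_segments_ball _ _ S x e cS)
  (rich_regular n1 e0 Sx regS) rank_middle_wf.
have /choice[pos posE] m : exists t : T, val t = q (node_rank m).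
  by have [Sq xq] := qU (node_rank m); exists (SigSub (mem_set (ST _ (conj Sq xq)))).
exists pos; split.
  by move=> a b ab; apply/node_rank_inj/qI; rewrite -!posE ab.
move=> a b c; rewrite !posE qP.
have E i j k : rank_middle (node_rank i) (node_rank j) (node_rank k) <-> middle i j k.
  split=> [[i' [j' [k' [h []]]]]|h]; last by exists i, j, k.
  by do 3!move=> /node_rank_inj ->.
by rewrite !E.
Qed.

(** P is the set of all placed points. Its strict betweenness is [middle] up to exchanging the ends,
    so the hypotheses of [haltF_false] follow by inversion. *)
Lemma expansion_halts (n1 : (1 <= n)%N) (hT : extends_linearly_2D T) c x :
  (forall P : set T, models (expansion P) (haltF c x)) ->
  exists u, ev c (Node Leaf (tseq [:: x])) u.
Proof.
have [pos [posI posP]] := points_exist n1 hT.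
pose P := [set t : T | exists m, t = pos m].
move=> /(_ P).
have betaE a b m : @sbeta (expansion P) (pos a) (pos m) (pos b) <->
    middle a b m \/ middle b a m.
  rewrite -posP; split=> [[h [h1 h2]]|[h [h1 h2]]]; split=> //; split.
  - by move=> /val_inj.
  - by move=> /val_inj.
  - by move=> e; apply: h1; rewrite e.
  - by move=> e; apply: h2; rewrite e.
apply: (@haltF_false (expansion P) (pos Tag1) (pos Tag2) (pos Tag3) (pos \o Val)).
- move=> y; split=> [[[m ->] [_ [[k ->] /betaE[]h]]]|[t ->]].
  + by inversion h; exists t.
  + by inversion h.
  split; first by exists (Val t).
  exists (pos (Lft t)); split; first by exists (Lft t).
  by apply/betaE; left; constructor.
- move=> a b y; split=> [|->].
    move=> [_ [_ [[[k ->] [l ->]] [[m ->] [/betaE h1 [/betaE h2 /betaE h3]]]]]].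
    have kE : k = Lft a by case: h1 => h1; inversion h1.
    have lE : l = Rgt b by case: h2 => h2; inversion h2.
    by rewrite kE lE in h3; case: h3 => h3; inversion h3.
  exists (pos (Lft a)), (pos (Rgt b)); split.
    by split; [exists (Lft a)|exists (Rgt b)].
  split; first by exists (Val (Node a b)).
  by split; [|split]; apply/betaE; left; constructor.
- move=> t; split=> [[_ [[k ->] /betaE[]h]]|ht].
  + by inversion h; subst.
  + by inversion h.
  exists (pos (Prv t)); split; first by exists (Prv t).
  by apply/betaE; left; constructor.
Qed.

End Points.

Theorem theorem4p15 (R : realType) (n : nat) (hn : (1 <= n)%N)
    (T : set 'rV[R]_n) (hT : extends_linearly_2D T) :
  Sigma01_hard [set godel phi | phi in theory_of (unary_expansion_class T)].
Proof.
move=> A /Sigma01_ev[c cP]; exists (fun x => godel (haltF c x)).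
  exact: computable_haltF.
move=> x; split=> [/cP[u cxu]|[phi [_ phiP] /godel_inj e]].
  exists (haltF c x) => //; split; first exact: sentence_haltF.
  by move=> M _; exact: haltF_true cxu.
apply/cP; apply: (expansion_halts hn hT) => P.
by rewrite -e; apply: phiP; exists P.
Qed.
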